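(* Let $G$ be a finite simple graph on vertices $x_1,\ldots,x_n$ with at least one edge, let $\mathbb{K}$ be a field, and let $I=I(G)\subset\mathbb{K}[x_1,\ldots,x_n]$ be its edge ideal. Then the asymptotic resurgence of $I$ is given by $$\rho_a(I)=\frac{2}{\widehat{\alpha}(I)},$$ where $\widehat{\alpha}(I)$ is the Waldschmidt constant of $I$.
   Context: The edge ideal is $I(G)=(x_ix_j:\{x_i,x_j\}\text{ is an edge of }G)$. For a squarefree monomial ideal $I$, $I^{(s)}=\bigcap_{P\in\mathrm{Ass}(I)}P^s$. The asymptotic resurgence is $\rho_a(I)=\sup\{\frac{s}{r}: s,r\text{ positive integers},\ I^{(st)}\not\subset I^{rt}\text{ for all } t\gg 0\}$. For a nonzero homogeneous ideal $J$, $\alpha(J)$ is the minimum degree of a nonzero polynomial in $J$. The Waldschmidt constant is $\widehat{\alpha}(I)=\lim_{s\to\infty}\frac{\alpha(I^{(s)})}{s}$. *)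

(* Defs.v *)
From HB Require Import structures.
(* The notations of mpoly clash with those of mathcomp-analysis; importing it
   first keeps [symmetric] for relations (mpoly has symmetric polynomials). *)
From mathcomp Require Import -(notations) mpoly.
From mathcomp Require Import all_boot all_order all_algebra.
From mathcomp Require Import all_classical all_reals all_analysis.
Set Implicit Arguments.
Unset Strict Implicit.
Unset Printing Implicit Defensive.
Import Order.TTheory GRing.Theory Num.Theory numFieldNormedType.Exports.
Local Open Scope classical_set_scope.
Local Open Scope ring_scope.

Section Ideals.
Variable A : comNzRingType.
Implicit Types I J P : set A.

(* Unlike [idealr_closed], this allows the improper ideal [setT], which is
   needed as the zeroth power of an ideal. *)
Definition is_ideal I : Prop :=
  I 0 /\ forall a u v, I u -> I v -> I (a * u + v).

Definition ideal_gen (X : set A) : set A := smallest is_ideal X.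

Definition ideal_mul I J : set A :=
  ideal_gen [set z | exists u v, [/\ I u, J v & z = u * v]].

Definition ideal_pow I (k : nat) : set A := iter k (ideal_mul I) setT.

Definition ideal_colon I (f : A) : set A := [set g | I (g * f)].

(* [idealr_closed] includes properness. *)
Definition is_prime_ideal P : Prop :=
  idealr_closed (mem P) /\ prime_idealr_closed (mem P).

(* Ass(I) stands for the associated primes of the module A / I, that is, the
   prime ideals which are annihilators of the class of some f in A / I. *)
Definition Ass I : set (set A) :=
  [set P | is_prime_ideal P /\ exists f, P = ideal_colon I f].

(* The symbolic power of a radical ideal; for ideals with embedded primes the
   definition in the literature is different. *)
Definition symbolic_pow I (s : nat) : set A :=
  \bigcap_(P in Ass I) ideal_pow P s.

Definition asymptotic_resurgence (R : realType) I : \bar R :=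
  ereal_sup [set q | exists s r : nat,
    [/\ (0 < s)%N, (0 < r)%N,
        \forall t \near \oo,
          ~ (symbolic_pow I (s * t) `<=` ideal_pow I (r * t))
      & q = (s%:R / r%:R)%:E]].

End Ideals.

Section Polynomials.
Variables (n : nat) (K : fieldType).
Local Notation S := (mpoly n K).
Implicit Types I J : set S.

(* [mmeasure mdeg p], also written [msize p], is the total degree of [p] plus
   one when [p] is nonzero. *)
Definition is_initial_degree J (d : nat) : Prop :=
  (exists p : S, [/\ J p, p != 0 & (mmeasure mdeg p).-1 = d]) /\
  (forall p : S, J p -> p != 0 -> (d <= (mmeasure mdeg p).-1)%N).

(* The default value 0 is only taken when J contains no nonzero polynomial. *)
Definition alpha J : nat := xget 0%N [set d | is_initial_degree J d].

(* The sequence converges for every proper nonzero homogeneous radical ideal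
   (alpha is subadditive along symbolic powers); its value at s = 0 is 0. *)
Definition waldschmidt (R : realType) I : R :=
  limn (fun s : nat => (alpha (symbolic_pow I s))%:R / s%:R : R).

Definition pvar (i : 'I_n) : S := mpolyX K (mnm1 i).

Definition edge_ideal (e : rel 'I_n) : set S :=
  ideal_gen [set p | exists i j, e i j /\ p = pvar i * pvar j].

End Polynomials.

Arguments edge_ideal {n} K e _.

(* Main.v *)
Require Import Defs.
From mathcomp Require Import -(notations) mpoly.
From mathcomp Require Import all_boot all_order all_algebra.
From mathcomp Require Import all_classical all_reals all_analysis.
From mathcomp Require Import ring lra zify.
Set Implicit Arguments.
Unset Strict Implicit.
Unset Printing Implicit Defensive.
Import Order.TTheory GRing.Theory Num.Theory numFieldNormedType.Exports.
Local Open Scope ring_scope.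

(** Write [I] for the edge ideal, [a s] for the initial degree of the [s]-th
symbolic power and [c] for the Waldschmidt constant.  Everything is decided on
monomials.  An associated prime contains, for each edge, one of its two
variables, and conversely every minimal vertex cover spans an associated prime.
Hence a monomial [x^m] lies in the [s]-th symbolic power iff every vertex cover
[C] has weight [m(C) >= s] ([symbolic_powE]); on the other side [x^m] lies in
[I^k] as soon as [k] edges, repetitions allowed, can be packed into [m]
([edge_packing_pow]).

The sequence [a s / s] converges to its infimum, so that [c * s <= a s]
([waldschmidtP]).  If [s / r < 2 / c], then for large [t] the [st]-th symbolic
power has an element of degree less than [2rt], while [I^(rt)] starts in degree
[2rt]: the containment fails.  This gives the lower bound.

For the upper bound, the largest fractional packing of edges into [m] is, by
linear programming duality, the least value of [w(m)] over fractional vertex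
covers [w].  An optimal [w] can be taken half-integral: it comes from a pair
[(A, B)] of vertex sets covering the bipartite double of the graph, as
[w = (1_A + 1_B) / 2].  Indeed Koenig duality on the double graph packs at least
[(m(A) + m(B) - n^2) / 2] edges into [m], the error coming from rounding
([koenig], [edge_packing]).  It remains to see that a monomial of the [s]-th
symbolic power satisfies [m(A) + m(B) >= c * s] ([cover_weight_ge]).  Let [k] be
the weight of [A :&: B].  Completing any vertex cover by [A :&: B] shows that the
restriction of [m] to the symmetric difference of [A] and [B] is an exponent of
the [(s - k)]-th symbolic power ([half_integral_cover]).  Therefore
[m(A) + m(B) >= 2k + c (s - k)], and [c <= 2] finishes the estimate.  As [n^2]
is a constant, [c * s > 2r] forces the containment for all large [t]. *)

(** * Koenig duality for b-matchings *)

Section BMatching.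
Local Open Scope nat_scope.
Variables (T U : finType) (e : T -> U -> bool) (a : T -> nat) (b : U -> nat).
Implicit Types (f g : T -> U -> nat).

Definition b_matching f : Prop :=
  [/\ forall i j, 0 < f i j -> e i j,
      forall i, \sum_j f i j <= a i & forall j, \sum_i f i j <= b j].

Definition incr i j f := fun x y => f x y + ((x == i) && (y == j)).
Definition decr i j f := fun x y => f x y - ((x == i) && (y == j)).

Lemma incr_decr i j f : 0 < f i j -> incr i j (decr i j f) =2 f.
Proof.
rewrite /incr /decr => f_gt0 x y; case: eqP => [->|_] /=;
  last by rewrite subn0 addn0.
by case: eqP => [->|_] /=; rewrite ?subnK ?subn0 ?addn0.
Qed.

Lemma incr_row i j f x : \sum_y incr i j f x y = \sum_y f x y + (x == i).
Proof.
rewrite big_split /=; congr (_ + _); case: (x == i) => /=; last by rewrite big1.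
rewrite (bigD1 j) //= eqxx big1 ?addn0 // => y.
by move=> /negbTE ->.
Qed.

Lemma incr_col i j f y : \sum_x incr i j f x y = \sum_x f x y + (y == j).
Proof.
rewrite big_split /=; congr (_ + _); case: (y == j) => /=; last first.
  by rewrite big1 // => x _; rewrite andbF.
rewrite (bigD1 i) //= eqxx big1 ?addn0 // => x /negbTE -> //.
Qed.

Lemma incr_total i j f :
  \sum_x \sum_y incr i j f x y = (\sum_x \sum_y f x y).+1.
Proof.
under eq_bigr do rewrite incr_row.
rewrite big_split -addn1 /=; congr (_ + _); rewrite (bigD1 i) //= eqxx.
by rewrite big1 // => x /negbTE ->.
Qed.

(** Contracted residual graph: an alternating path leaves [i] by an edge, whose
use can be increased freely, and returns to [i'] along a used edge.  Only the
vertices on the left are recorded. *)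
Definition residual f := [rel i i' | [exists j, e i j && (0 < f i' j)]].

(** Moving one unit from [(i', j)] to [(i, j)] along the first step of the path
makes [i'] the free vertex and keeps the total; an increment at the end of the
path then gains one unit.  The path must not repeat vertices: the decrement at
[i'] could otherwise destroy a later step. *)
Lemma augmenting_path p i f :
    b_matching f -> \sum_j f i j < a i -> uniq (i :: p) ->
    path (residual f) i p ->
    [exists j, e (last i p) j && (\sum_x f x j < b j)] ->
  exists2 f', b_matching f' &
    \sum_x \sum_y f' x y = (\sum_x \sum_y f x y).+1.
Proof.
elim: p i f => [|i' p IHp] i f /=.
  move=> [fe fa fb] i_free _ _ /existsP[j /andP[eij j_free]].
  exists (incr i j f); last exact: incr_total.
  split=> [x y|x|y].
  - rewrite /incr; case: eqP => [->|_] /=; [case: eqP => [->|_] //=|];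
      by rewrite addn0; apply: fe.
  - by rewrite (incr_row i j f); case: eqP => [->|_]; rewrite ?addn1 ?addn0.
  - by rewrite (incr_col i j f); case: eqP => [->|_]; rewrite ?addn1 ?addn0.
move=> [fe fa fb] i_free /andP[]; rewrite inE negb_or => /andP[ii' _].
move=> /andP[i'p p_uniq] /andP[/existsP[j /andP[eij f_gt0]] p_path] p_end.
set g := decr i' j f; set f' := incr i j g.
have fE := incr_decr f_gt0; rewrite -/g in fE.
have rowf x : \sum_y f x y = \sum_y g x y + (x == i').
  by rewrite -(incr_row i' j g); apply: eq_bigr => y _; rewrite fE.
have colf y : \sum_x f x y = \sum_x g x y + (y == j).
  by rewrite -(incr_col i' j g); apply: eq_bigr => x _; rewrite fE.
have col_eq y : \sum_x f' x y = \sum_x f x y by rewrite (incr_col i j g) colf.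
have -> : \sum_x \sum_y f x y = \sum_x \sum_y f' x y.
  by rewrite exchange_big [RHS]exchange_big; apply: eq_bigr => y _;
    rewrite col_eq.
apply: (IHp i' f').
- split=> [x y|x|y]; last by rewrite col_eq.
  + rewrite /f' /incr; case: eqP => [->|_] /=; [case: eqP => [->|_] //=|];
      rewrite addn0 /g /decr => gt0; apply: fe;
      apply: leq_trans gt0 (leq_subr _ _).
  + rewrite incr_row; case: eqP => [->|_]; last first.
      by rewrite addn0; apply: leq_trans (fa x); rewrite rowf leq_addr.
    by rewrite addn1; move: i_free; rewrite rowf (negbTE ii') addn0.
- apply: leq_trans (fa i'); rewrite rowf incr_row eqxx eq_sym (negbTE ii').
  by rewrite addn0 addn1.
- by rewrite /= i'p.
- apply/(pathP i) => k kp; have := (pathP i p_path) k kp.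
  move=> /existsP[y /andP[exy fxy]]; apply/existsP; exists y; rewrite exy /=.
  have: nth i p k != i' by apply: contraNneq i'p => <-; apply: mem_nth.
  move=> /negbTE k_i'; move: fxy; rewrite -fE /f' /incr k_i' addn0.
  by move=> /leq_trans; apply; apply: leq_addr.
- move: p_end => /existsP[y /andP[ey yb]]; apply/existsP; exists y.
  by rewrite ey col_eq.
Qed.

(** Either some vertex reachable from a free one has an unsaturated neighbour,
and the matching can be augmented, or the unreachable vertices on the left and
the neighbours of the reachable ones on the right form a cover.  In the second
case all of them are saturated and no used edge is counted twice, so the cover
weighs exactly as much as the matching. *)
Lemma koenig_step f : b_matching f ->
  (exists2 f', b_matching f' &
    \sum_x \sum_y f' x y = (\sum_x \sum_y f x y).+1) \/
  exists (A : {set T}) (B : {set U}),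
    (forall i j, e i j -> (i \in A) || (j \in B)) /\
    \sum_(i in A) a i + \sum_(j in B) b j = \sum_x \sum_y f x y.
Proof.
move=> bf; have [fe fa fb] := bf.
pose free i := \sum_j f i j < a i.
pose reach := [set i | [exists i0, free i0 && connect (residual f) i0 i]].
pose B := [set j | [exists i in reach, e i j]].
have [/existsP[j /andP[jB j_free]]|no_aug] :=
    boolP [exists j, (j \in B) && (\sum_x f x j < b j)].
  left; move: jB; rewrite inE => /existsP[i /andP[]].
  rewrite inE => /existsP[i0 /andP[i0_free /connectP[p0 p0_path ->]]] eij.
  case/shortenP: p0_path eij => p p_path p_uniq _ eij.
  apply: (augmenting_path bf i0_free p_uniq p_path).
  by apply/existsP; exists j; rewrite eij.
right; exists (~: reach), B; split=> [i j eij|].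
  rewrite inE; case: (boolP (i \in reach)) => //= i_reach.
  by rewrite inE; apply/existsP; exists i; rewrite i_reach.
have row_full i : i \in ~: reach -> a i = \sum_y f i y.
  rewrite !inE => /existsPn/(_ i); rewrite connect0 andbT /free -leqNgt => le_a.
  by apply/eqP; rewrite eqn_leq le_a fa.
have col_full j : j \in B -> b j = \sum_x f x j.
  move=> jB; apply/eqP; rewrite eqn_leq fb andbT.
  by move/existsPn: no_aug => /(_ j); rewrite jB /= -leqNgt.
(* A used edge into [B] can be traversed backwards from a reachable vertex. *)
have crossing i j : j \in B -> i \notin reach -> f i j = 0.
  rewrite inE => /existsP[i1 /andP[]].
  rewrite inE => /existsP[i0 /andP[i0_free i01]] e1j i_nreach.
  apply/eqP; rewrite -leqn0 leqNgt; apply: contra i_nreach => f_gt0.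
  rewrite inE; apply/existsP; exists i0; rewrite i0_free /=.
  apply: connect_trans i01 (connect1 _); apply/existsP; exists j.
  by rewrite e1j.
rewrite (eq_bigr _ row_full) (eq_bigr _ col_full) [X in _ + X]exchange_big /=.
rewrite [RHS](bigID (mem (~: reach))) /=; congr (_ + _).
rewrite (bigID (mem (~: reach))) /= big1 ?add0n => [|i iA]; last first.
  rewrite big1 // => j jB; apply: crossing => //; by rewrite inE in iA.
apply: eq_bigr => i; rewrite inE negbK => i_reach.
rewrite [RHS](bigID (mem B)) /= [X in _ + X]big1 ?addn0 // => j.
apply: contraNeq; rewrite -lt0n => /fe eij.
by rewrite inE; apply/existsP; exists i; rewrite i_reach.
Qed.

Theorem koenig : exists f (A : {set T}) (B : {set U}),
  [/\ b_matching f, forall i j, e i j -> (i \in A) || (j \in B) &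
      \sum_(i in A) a i + \sum_(j in B) b j = \sum_x \sum_y f x y].
Proof.
have total_le f : b_matching f -> \sum_x \sum_y f x y <= \sum_x a x.
  by move=> [_ fa _]; apply: leq_sum => i _.
(* [k] bounds the number of augmentations that are still possible. *)
suff koenig_from k f : b_matching f -> \sum_x a x <= \sum_x \sum_y f x y + k ->
    exists f (A : {set T}) (B : {set U}),
    [/\ b_matching f, forall i j, e i j -> (i \in A) || (j \in B) &
      \sum_(i in A) a i + \sum_(j in B) b j = \sum_x \sum_y f x y].
  apply: (koenig_from (\sum_x a x) (fun _ _ => 0)) (leq_addl _ _).
  by split=> // x; rewrite big1.
elim: k f => [|k IHk] f bf le_k;
  have [[f' bf' f'E]|[A [B [cov AB]]]] := koenig_step bf.
- by have := leq_trans (total_le _ bf') le_k; rewrite f'E addn0 ltnn.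
- by exists f, A, B.
- by apply: (IHk f' bf'); rewrite f'E addSnnS.
- by exists f, A, B.
Qed.

End BMatching.

(** * Vertex covers and packings of edges *)

Section Covers.
Local Open Scope nat_scope.
Variables (T : finType) (e : rel T).
Implicit Types (m : T -> nat) (A B C : {set T}).

Definition vertex_cover C :=
  [forall i, forall j, e i j ==> (i \in C) || (j \in C)].

Lemma vertex_coverP C :
  reflect (forall i j, e i j -> (i \in C) || (j \in C)) (vertex_cover C).
Proof.
apply: (iffP forallP) => [+ i j|cC i].
  by move=> /(_ i)/forallP/(_ j)/implyP.
by apply/forallP => j; apply/implyP; apply: cC.
Qed.

(** These are the exponents of the monomials in the [s]-th symbolic power of the
edge ideal; see [symbolic_powE]. *)
Definition symbolic_exponent m s : Prop :=
  forall C, vertex_cover C -> s <= \sum_(i in C) m i.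

(** Koenig duality on the bipartite double of the graph gives [f] with row and
column sums at most [m]; as each vertex of the graph occurs on both sides, [f]
is twice a fractional packing.  Rounding the halves down loses at most one half
per pair of vertices. *)
Lemma edge_packing m : exists (h : T -> T -> nat) A B,
  [/\ forall i j, 0 < h i j -> e i j,
      forall i, \sum_j h i j + \sum_j h j i <= m i,
      forall i j, e i j -> (i \in A) || (j \in B) &
      \sum_(i in A) m i + \sum_(i in B) m i
        <= (\sum_i \sum_j h i j).*2 + #|T| ^ 2].
Proof.
have [f [A [B [[fe fa fb] cov AB]]]] := koenig e m m.
exists (fun i j => (f i j)./2), A, B; split=> //.
- by move=> i j h_gt0; apply: fe; case: (f i j) h_gt0.
- move=> i; rewrite -leq_double doubleD -[(m i).*2]addnn -!mul2n !big_distrr /=.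
  apply: leq_add; [apply: leq_trans (fa i)|apply: leq_trans (fb i)];
    by apply: leq_sum => j _; rewrite mul2n -[leqRHS]odd_double_half leq_addl.
rewrite AB -mul2n big_distrr /= -mulnn -{1}sum1_card big_distrl -big_split /=.
apply: leq_sum => i _; rewrite big_distrr mul1n -sum1_card -big_split /=.
apply: leq_sum => j _; rewrite mul2n addnC -[leqLHS]odd_double_half leq_add2r.
by case: odd.
Qed.

Hypothesis e_sym : symmetric e.

(** The witnesses are the weight [k] of [A :&: B] and the restriction [m'] of [m]
to the symmetric difference of [A] and [B].  A vertex in neither set has all its
neighbours in [A :&: B], by symmetry of [e]; hence the part of a vertex cover [C]
inside the symmetric difference, together with [A :&: B], is again a vertex
cover. *)
Lemma half_integral_cover m s A B : symbolic_exponent m s ->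
    (forall i j, e i j -> (i \in A) || (j \in B)) ->
  exists k m', symbolic_exponent m' (s - k) /\
    k.*2 + \sum_i m' i = \sum_(i in A) m i + \sum_(i in B) m i.
Proof.
move=> ms cov; pose m' i := if i \in (A :|: B) :\: (A :&: B) then m i else 0.
exists (\sum_(i in A :&: B) m i), m'; split=> [C /vertex_coverP cC|]; last first.
  rewrite -mul2n big_distrr (big_mkcond (mem A)) (big_mkcond (mem B)).
  rewrite (big_mkcond (fun i => i \in _)) -!big_split /=.
  apply: eq_bigr => i _; rewrite /m' !inE.
  by case: (i \in A); case: (i \in B); rewrite /= ?mul2n ?addnn ?addn0.
rewrite leq_subLR.
have /ms /leq_trans :
    vertex_cover ((A :&: B) :|: (C :&: ((A :|: B) :\: (A :&: B)))).
  apply/vertex_coverP => i j eij; move: (cov _ _ eij) (cC _ _ eij).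
  have := cov j i; rewrite e_sym => /(_ eij); rewrite !inE.
  case: (i \in A); case: (i \in B); case: (j \in A); case: (j \in B) => //=;
    by case: (i \in C); case: (j \in C).
apply; rewrite !(big_mkcond (fun i => i \in _)) -big_split /=.
apply: leq_sum => i _; rewrite /m' !inE.
by case: (i \in A); case: (i \in B); case: (i \in C); rewrite /= ?addn0.
Qed.

End Covers.

(** * Generated ideals and powers *)

Local Open Scope classical_set_scope.

Section MoreIdeals.
Variable A : comNzRingType.
Implicit Types (I J P : set A).

Lemma ideal_add I x y : is_ideal I -> I x -> I y -> I (x + y).
Proof. by move=> [_ II] Ix Iy; rewrite -[x]mul1r; apply: II. Qed.

Lemma ideal_mull I a x : is_ideal I -> I x -> I (a * x).
Proof. by move=> [I0 II] Ix; rewrite -[_ * _]addr0; apply: II. Qed.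

Lemma ideal_opp I x : is_ideal I -> I x -> I (- x).
Proof. by move=> II Ix; rewrite -mulN1r; apply: ideal_mull. Qed.

Lemma ideal_sum I (T : eqType) (r : seq T) (F : T -> A) : is_ideal I ->
  (forall x, x \in r -> I (F x)) -> I (\sum_(x <- r) F x).
Proof.
move=> II IF; rewrite big_seq; apply: big_ind => //; first by case: II.
by move=> x y; apply: ideal_add.
Qed.

Lemma ideal_gen_is_ideal (X : set A) : is_ideal (ideal_gen X).
Proof.
split=> [J [[]]//|a u v Iu Iv J XJ].
have [[_ JJ] _] := XJ; by apply: JJ; [apply: Iu|apply: Iv].
Qed.

Lemma ideal_gen_sub (X J : set A) : is_ideal J -> X `<=` J ->
  ideal_gen X `<=` J.
Proof. by move=> JJ XJ p; apply. Qed.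

Lemma sub_ideal_gen (X : set A) : X `<=` ideal_gen X.
Proof. by move=> p Xp J [_]; apply. Qed.

Lemma ideal_pow_is_ideal I k : is_ideal (ideal_pow I k).
Proof. by case: k => [|k] //; apply: ideal_gen_is_ideal. Qed.

Lemma ideal_powM I k x y : I x -> ideal_pow I k y -> ideal_pow I k.+1 (x * y).
Proof. by move=> Ix Iy; apply: sub_ideal_gen; exists x, y. Qed.

Lemma prime_ideal_is_ideal P : is_prime_ideal P -> is_ideal P.
Proof.
move=> [[P0 _ PP] _]; split=> [|a u v Pu Pv]; apply: set_mem => //.
by apply: PP; apply: mem_set.
Qed.

End MoreIdeals.

(** * Monomial ideals *)

Section MonomialIdeals.
Variables (n : nat) (K : fieldType).
Local Notation S := (mpoly n K).
Local Notation X := (mpolyX K).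
Implicit Types (p q : S) (m : multinom n) (U V : set (multinom n)).

Definition up_closed U : Prop := forall m k, U m -> U (mnm_add m k).

(** When [U] is up-closed, this is the monomial ideal with exponent set [U].  The
definition makes sense for all [U], and [mon_ideal_split] uses it for the
polynomials supported on a complement. *)
Definition mon_ideal U : set S := [set p | forall m, m \in msupp p -> U m].

Lemma mon_ideal_is_ideal U : up_closed U -> is_ideal (mon_ideal U).
Proof.
move=> Uup; split=> [m|a p q Up Uq m /msuppD_le]; first by rewrite msupp0.
rewrite mem_cat => /orP[/msuppM_le/allpairsP[[m1 m2] /= [_ m2p ->]]|/Uq//].
by rewrite addmC; apply: Uup; apply: Up.
Qed.

Lemma mon_idealX U m : mon_ideal U (X m) <-> U m.
Proof.
split=> [|Um k]; first by apply; rewrite msuppX mem_seq1.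
by rewrite msuppX mem_seq1 => /eqP->.
Qed.

Lemma mon_ideal_sub U (J : set S) : is_ideal J ->
  (forall m, U m -> J (X m)) -> mon_ideal U `<=` J.
Proof.
move=> JJ UJ p Up; rewrite (mpolyE p); apply: ideal_sum => // m mp.
by rewrite -mul_mpolyC; apply: ideal_mull => //; apply: UJ; apply: Up.
Qed.

(** This serves as reduction modulo a monomial ideal: [p1] is the normal form
of [p]. *)
Lemma mon_ideal_split U p : exists2 p1, mon_ideal U (p - p1) &
  mon_ideal (~` U) p1.
Proof.
pose s := msupp p.
pose part (b : bool) := \sum_(m <- s | `[< U m >] == b) mcoeff m p *: X m.
have part_in (b : bool) m : m \in msupp (part b) -> `[< U m >] == b.
  move=> /msupp_sum_le /flattenP[r /mapP[k]].
  rewrite mem_filter => /andP[Uk _] ->.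
  by move=> /msuppZ_le; rewrite msuppX mem_seq1 => /eqP ->.
have pE : p = part true + part false.
  rewrite [LHS]mpolyE (bigID (fun m => `[< U m >])) /=.
  congr (_ + _); apply: eq_bigl => m.
    by rewrite eqb_id.
  by rewrite eqbF_neg.
exists (part false) => m.
  by rewrite {1}pE addrK => /part_in; rewrite eqb_id => /asboolP.
by move=> /part_in; rewrite eqbF_neg => /asboolPn.
Qed.

Definition wt (C : {set 'I_n}) m : nat := \sum_(i in C) m i.

Lemma wtD C m k : wt C (mnm_add m k) = (wt C m + wt C k)%N.
Proof. by rewrite /wt -big_split; apply: eq_bigr => i _; rewrite mnmDE. Qed.

Definition wt_ge C d : set (multinom n) := [set m | (d <= wt C m)%N].

Lemma wt_ge_up C d : up_closed (wt_ge C d).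
Proof.
by move=> m k; rewrite /wt_ge /= wtD => /leq_trans->//; apply: leq_addr.
Qed.

Lemma ideal_pow_wt_ge C d (J : set S) k : J `<=` mon_ideal (wt_ge C d) ->
  ideal_pow J k `<=` mon_ideal (wt_ge C (k * d)).
Proof.
move=> Jd; elim: k => [|k IHk].
  by move=> p _ m _; rewrite /wt_ge /= mul0n.
apply: ideal_gen_sub; first by apply/mon_ideal_is_ideal/wt_ge_up.
move=> _ [u [v [Ju /IHk Jv ->]]] m.
move=> /msuppM_le/allpairsP[[m1 m2] /= [m1u m2v ->]].
by rewrite /wt_ge /= wtD mulSn; apply: leq_add; [apply: Jd m1u|apply: Jv].
Qed.

(** This is the ideal generated by the variables in [C].  Reduced modulo it, two
polynomials outside of the ideal have leading monomials of weight 0, and so does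
their product. *)
Lemma wt_ge1_prime C : is_prime_ideal (mon_ideal (wt_ge C 1)).
Proof.
set P := mon_ideal _; have PP : is_ideal P by apply/mon_ideal_is_ideal/wt_ge_up.
split; first split.
- by apply: mem_set; case: PP.
- apply/negP => /set_mem /(_ mnm0); rewrite msupp1 mem_seq1 eqxx => /(_ isT).
  by rewrite /wt_ge /= /wt big1 // => i _; rewrite mnm0E.
- by move=> a u v /set_mem Pu /set_mem Pv; apply: mem_set; case: PP => _; apply.
move=> u v /set_mem Puv; apply/negPn; rewrite negb_or.
apply/negP => /andP[uP vP].
have [u1 Pu u1P] := mon_ideal_split (wt_ge C 1) u.
have [v1 Pv v1P] := mon_ideal_split (wt_ge C 1) v.
have u1_neq0 : u1 != 0.
  by apply: contra uP => /eqP u10; apply: mem_set; rewrite -[u]subr0 -u10.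
have v1_neq0 : v1 != 0.
  by apply: contra vP => /eqP v10; apply: mem_set; rewrite -[v]subr0 -v10.
have Puv1 : P (u1 * v1).
  have -> : u1 * v1 = u * v - (u1 * (v - v1) + v * (u - u1)).
    ring.
  apply: (ideal_add PP Puv (ideal_opp PP _)).
  by apply: (ideal_add PP (ideal_mull _ PP Pv) (ideal_mull _ PP Pu)).
have /Puv1 : mlead (u1 * v1) \in msupp (u1 * v1).
  by rewrite mlead_supp ?mulf_neq0.
rewrite mleadM // /wt_ge /= wtD.
have /u1P/negP := mlead_supp u1_neq0; have /v1P/negP := mlead_supp v1_neq0.
by rewrite -!eqn0Ngt => /eqP-> /eqP->.
Qed.

End MonomialIdeals.

(** * Powers and symbolic powers of edge ideals *)

Section EdgeIdeals.
Variables (n : nat) (K : fieldType) (e : rel 'I_n).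
Hypotheses (e_sym : symmetric e) (e_irr : irreflexive e).
Local Notation S := (mpoly n K).
Local Notation X := (mpolyX K).
Local Notation I := (edge_ideal K e).
Implicit Types (p q : S) (m : multinom n) (C : {set 'I_n}).

Definition has_edge m : Prop :=
  exists i j, [/\ e i j, (0 < m i)%N & (0 < m j)%N].

Lemma has_edge_up : up_closed has_edge.
Proof.
by move=> m k [i [j [eij mi mj]]]; exists i, j; rewrite !mnmDE !ltn_addr.
Qed.

Lemma edge_idealX i j m : e i j ->
  I (X (mnm_add (mnm_add (mnm1 i) (mnm1 j)) m)).
Proof.
move=> eij; rewrite !mpolyXD mulrC; apply: ideal_mull (ideal_gen_is_ideal _) _.
by apply: sub_ideal_gen; exists i, j.
Qed.

Lemma edge_split i j m : e i j -> (0 < m i)%N -> (0 < m j)%N ->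
  m = mnm_add (mnm_add (mnm1 i) (mnm1 j))
              (mnm_sub (mnm_sub m (mnm1 i)) (mnm1 j)).
Proof.
move=> eij mi mj; apply/mnmP => k; rewrite !mnmDE !mnmBE !mnm1E.
have [ik|] := eqVneq i k; have [jk|] := eqVneq j k;
  rewrite -?ik -?jk /=; try lia.
by move: eij; rewrite ik jk e_irr.
Qed.

Lemma edge_idealE : I = mon_ideal has_edge :> set S.
Proof.
apply/seteqP; split.
  apply: ideal_gen_sub; first exact/mon_ideal_is_ideal/has_edge_up.
  move=> _ [i [j [eij ->]]]; rewrite -mpolyXD; apply/mon_idealX.
  by exists i, j; split; rewrite // !mnmDE !mnm1E eqxx; lia.
apply: mon_ideal_sub (ideal_gen_is_ideal _) _ => m [i [j [eij mi mj]]].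
by rewrite (edge_split eij mi mj); apply: edge_idealX.
Qed.

(** The prime generated by the variables of [C] is the annihilator, modulo the
edge ideal, of the product [x^c] of the variables outside [C].  By minimality each vertex of [C] has a
neighbour outside [C], so the variables of [C] multiply [x^c] into the edge
ideal; a monomial in the other variables does not, because the complement of [C]
is independent. *)
Lemma minimal_cover_Ass C : minset (vertex_cover e) C ->
  Ass I (mon_ideal (wt_ge C 1) : set S).
Proof.
move=> /minsetP[/vertex_coverP cC minC]; split; first exact: wt_ge1_prime.
pose c := Multinom (mktuple (fun i => nat_of_bool (i \notin C))).
have cE i : c i = (i \notin C) by rewrite mnmE.
exists (X c); rewrite edge_idealE; apply/seteqP; split=> p.
  move=> Pp _ /msuppM_le/allpairsP[[m k] /= [mp + ->]].
  rewrite msuppX mem_seq1 => /eqP->.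
  have := Pp _ mp; rewrite /wt_ge /= /wt lt0n sum_nat_eq0 negb_forall.
  move=> /existsP[i]; rewrite negb_imply -lt0n => /andP[iC mi].
  have : ~~ vertex_cover e (C :\ i).
    by apply/negP => /minC /(_ (subD1set _ _)) Ci; move: iC; rewrite -Ci setD11.
  rewrite /vertex_cover negb_forall => /existsP[j].
  rewrite negb_forall => /existsP[k'].
  rewrite negb_imply !inE negb_or !negb_and !negbK.
  move=> /andP[ejk /andP[jE kE]].
  have [l [eil lC]] : exists l, e i l /\ l \notin C.
    move: (cC _ _ ejk) jE kE => /orP[jC|kC].
      rewrite jC orbF => /eqP ji.
      rewrite -ji => /orP[/eqP kj|kC]; last by exists k'.
      by move: ejk; rewrite kj ji e_irr.
    rewrite kC orbF => + /eqP ki; rewrite -ki => /orP[/eqP kj|jC].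
      by move: ejk; rewrite kj ki e_irr.
    by exists j; rewrite e_sym.
  by exists i, l; rewrite !mnmDE !cE lC ltn_addr // addn1.
move=> Ip m mp; rewrite /wt_ge /= lt0n; apply/negP => /eqP wm0.
have m0 i : i \in C -> m i = 0%N.
  move=> iC; move/eqP: wm0; rewrite /wt sum_nat_eq0.
  by move=> /forall_inP/(_ i iC)/eqP.
have [|i [j [eij]]] := Ip (mnm_add c m).
  by rewrite (perm_mem (msuppMX _ _)); apply/mapP; exists m.
rewrite !mnmDE !cE => ci cj; case/orP: (cC _ _ eij) => [iC|jC].
  by move: ci; rewrite iC (m0 i iC).
by move: cj; rewrite jC (m0 j jC).
Qed.

(** Every cover contains a minimal one, which gives an associated prime; this
bounds the weights from below.  Conversely each associated prime contains the
edge ideal, so the variables in it form a vertex cover [C], and a monomial of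
weight at least [s] on [C] is in its [s]-th power. *)
Lemma symbolic_powE s :
  symbolic_pow I s = mon_ideal [set m | symbolic_exponent e m s] :> set S.
Proof.
apply/seteqP; split=> p.
  move=> Ip m mp C cC; have [D minD DC] := minset_exists cC.
  have /ideal_pow_wt_ge :
    mon_ideal (K := K) (wt_ge D 1) `<=` mon_ideal (wt_ge D 1) by [].
  move=> /(_ s) /(_ p (Ip _ (minimal_cover_Ass minD)) m mp).
  rewrite /wt_ge /= muln1 => /leq_trans; apply.
  rewrite [leqRHS](big_setID D) /= (finset.setIidPr DC); apply: leq_addr.
move=> + P [primeP [f Pf]].
apply: mon_ideal_sub; first exact: ideal_pow_is_ideal.
have PP := prime_ideal_is_ideal primeP.
pose C := [set i | pvar K i \in P]%SET.
have cC : vertex_cover e C.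
  apply/vertex_coverP => i j eij; rewrite !inE.
  apply: (primeP.2 (pvar K i) (pvar K j)); apply: mem_set.
  rewrite Pf /ideal_colon /= mulrC.
  apply: ideal_mull (ideal_gen_is_ideal _) _.
  by apply: sub_ideal_gen; exists i, j.
move=> m /(_ C cC); elim: s m => [//|s IHs] m sm.
have [i [iC mi]] : exists i : 'I_n, i \in C /\ (0 < m i)%N.
  have : (\sum_(i in C) m i)%N != 0%N by rewrite -lt0n (leq_trans _ sm).
  rewrite sum_nat_eq0 negb_forall => /existsP[i].
  by rewrite negb_imply -lt0n => /andP[]; exists i.
have -> : m = mnm_add (mnm1 i) (mnm_sub m (mnm1 i)).
  apply/mnmP => k; rewrite mnmDE mnmBE mnm1E.
  by case: eqP => [<-|_] /=; rewrite ?subnKC ?subn0.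
rewrite mpolyXD; apply: ideal_powM; first by move: iC; rewrite inE => /set_mem.
apply: IHs; move: sm; rewrite !(bigD1 i iC) /= mnmBE mnm1E eqxx.
rewrite [X in _ -> (_ <= _ + X)%N](eq_bigr m) => [|k /andP[_ /negbTE ki]].
  by rewrite -{1}(subnKC mi) -addnA add1n ltnS.
by rewrite mnmBE mnm1E eq_sym ki subn0.
Qed.

(** [h i j] counts how often the edge [x_i x_j] is used as a factor of [x^m]; both
orientations of an edge may be used. *)
Lemma edge_packing_pow (h : 'I_n -> 'I_n -> nat) m k :
    (forall i j, (0 < h i j)%N -> e i j) ->
    (forall i, (\sum_j h i j + \sum_j h j i <= m i)%N) ->
    (k <= \sum_i \sum_j h i j)%N ->
  ideal_pow I k (X m : S).
Proof.
elim: k h m => [//|k IHk] h m he hm kh.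
have [i [j h_gt0]] : exists i j, (0 < h i j)%N.
  have : (\sum_i \sum_j h i j)%N != 0%N by rewrite -lt0n (leq_trans _ kh).
  rewrite sum_nat_eq0 negb_forall => /existsP[i] /=.
  rewrite sum_nat_eq0 negb_forall => /existsP[j] /=.
  by rewrite -lt0n; exists i, j.
have eij := he _ _ h_gt0.
have hE := incr_decr h_gt0; set g := decr i j h in hE.
have rowh x : (\sum_y h x y = \sum_y g x y + (x == i))%N.
  by rewrite -(incr_row i j g); apply: eq_bigr => y _; rewrite hE.
have colh y : (\sum_x h x y = \sum_x g x y + (y == j))%N.
  by rewrite -(incr_col i j g); apply: eq_bigr => x _; rewrite hE.
have toth : (\sum_x \sum_y h x y = (\sum_x \sum_y g x y).+1)%N.
  rewrite -(incr_total i j g).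
  by apply: eq_bigr => x _; apply: eq_bigr => y _; rewrite hE.
have mx x : (\sum_y g x y + \sum_y g y x + (x == i) + (x == j) <= m x)%N.
  by apply: leq_trans (hm x); rewrite rowh colh addnACA addnA.
have mi : (0 < m i)%N by apply: leq_trans (mx i); rewrite eqxx addnAC addn1.
have mj : (0 < m j)%N by apply: leq_trans (mx j); rewrite eqxx addn1.
rewrite (edge_split eij mi mj) !mpolyXD; apply: ideal_powM.
  by apply: sub_ideal_gen; exists i, j.
apply: (IHk g).
- by move=> x y gxy; apply: he; apply: leq_trans gxy _; apply: leq_subr.
- move=> x; rewrite !mnmBE !mnm1E [i == x]eq_sym [j == x]eq_sym -subnDA.
  by apply: leq_trans (leq_sub2r _ (mx x)); rewrite -addnA addnK.
- by move: kh; rewrite toth.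
Qed.

Lemma edge_ideal_pow_deg k p m : ideal_pow I k p -> m \in msupp p ->
  (k.*2 <= mdeg m)%N.
Proof.
have wtT k' : wt [set: 'I_n]%SET k' = mdeg k'.
  by rewrite mdegE /wt; apply: eq_bigl => i; rewrite inE.
have /(ideal_pow_wt_ge) : I `<=` mon_ideal (K := K) (wt_ge [set: 'I_n]%SET 2).
  rewrite edge_idealE => q Iq k' k'q; have [i [j [eij mi mj]]] := Iq _ k'q.
  by rewrite /wt_ge /= wtT (edge_split eij mi mj) !mdegD !mdeg1; lia.
by move=> /(_ k) Ik /Ik /[apply]; rewrite /wt_ge /= wtT muln2.
Qed.

(** A monomial ideal contains the leading monomials of its elements, so its
initial degree is attained at a monomial. *)
Lemma alpha_mon_ideal (U : set (multinom n)) : U !=set0 ->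
  (exists2 m, U m & mdeg m = alpha (mon_ideal U : set S)) /\
  (forall m, U m -> (alpha (mon_ideal U : set S) <= mdeg m)%N).
Proof.
move=> [m0 Um0].
have exd : exists d, `[< exists2 m, U m & mdeg m = d >].
  by exists (mdeg m0); apply/asboolP; exists m0.
case: (ex_minnP exd) => d /asboolP[m1 Um1 m1d] dmin.
have Ud m : U m -> (d <= mdeg m)%N.
  by move=> Um; apply: dmin; apply/asboolP; exists m.
have : is_initial_degree (mon_ideal U : set S) d.
  split; first exists (X m1).
    split; [by apply/mon_idealX| |by rewrite msizeX].
    by rewrite -msupp_eq0 msuppX.
  move=> p Up p0; rewrite -(mlead_deg p0) /=.
  by apply: Ud; apply: Up; apply: mlead_supp.
move=> dinit; suff -> : alpha (mon_ideal U : set S) = d.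
  by split=> //; exists m1.
apply: xget_unique => // d' [[p [Up p0 pd']] d'min].
apply/eqP; rewrite eqn_leq; apply/andP; split.
  rewrite -m1d; have := d'min (X m1); rewrite msizeX; apply.
    by apply/mon_idealX.
  by rewrite -msupp_eq0 msuppX.
by rewrite -pd'; apply: dinit.2.
Qed.

End EdgeIdeals.

(** * Convergence of the ratios *)

Section Ratio.
Variables (R : realType) (a : nat -> nat).
Hypothesis a_mono : forall s t, (s <= t)%N -> (a s <= a t)%N.
Hypothesis a_mul : forall q s, (a (q * s) <= q * a s)%N.

Local Notation u := (fun s : nat => (a s)%:R / s%:R : R).

(** A variant of Fekete's lemma, where monotonicity makes multiplicativity enough:
with [c] the infimum and [s0] nearly attaining it,
[a s <= a ((s %/ s0).+1 * s0) <= (s / s0 + 1) * a s0], hence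
[a s / s <= a s0 / s0 + a s0 / s]. *)
Lemma ratio_cvg :
  exists2 c : R, u s @[s --> \oo] --> c & forall s, c * s%:R <= (a s)%:R.
Proof.
pose c := inf [set u s | s in [set s : nat | (0 < s)%N]].
have lb0 : lbound [set u s | s in [set s : nat | (0 < s)%N]] 0.
  by move=> _ [s _ <-]; apply: divr_ge0.
have a0 : a 0 = 0%N by apply/eqP; have := a_mul 0 0; rewrite mul0n leqn0.
have c_ge0 : 0 <= c by apply: lb_le_inf => //; exists (u 1%N), 1%N.
have c_le s : (0 < s)%N -> c <= u s.
  by move=> s0; apply: ge_inf; [exists 0|exists s].
exists c; last first.
  case=> [|s]; first by rewrite a0 mulr0.
  by rewrite -ler_pdivlMr ?ltr0n //; apply: c_le.
apply/cvgrPdist_lt => eps eps0.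
have [_ [s0 s0_gt0 <-] us0] : exists2 x,
    [set u s | s in [set s : nat | (0 < s)%N]] x & x < c + eps / 2.
  apply: inf_adherent; first by rewrite divr_gt0.
  by split; [exists (u 1%N), 1%N|exists 0].
near=> s.
have s_gt0 : (0 < s)%N by near: s; exists 1%N.
rewrite ler0_norm ?subr_le0 ?c_le // opprB.
have s0R : 0 < s0%:R :> R by rewrite ltr0n.
have sR : 0 < s%:R :> R by rewrite ltr0n.
have as_le : (a s)%:R <= (s%:R / s0%:R + 1) * (a s0)%:R :> R.
  have : (a s)%:R <= ((s %/ s0).+1 * a s0)%:R :> R.
    rewrite ler_nat; apply: leq_trans (a_mul _ _); apply: a_mono.
    exact/ltnW/ltn_ceil.
  move=> /le_trans; apply; rewrite natrM ler_wpM2r // -natr1 lerD2r.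
  by rewrite ler_pdivlMr // -natrM ler_nat leq_trunc_div.
have us_le : u s <= u s0 + (a s0)%:R / s%:R.
  rewrite ler_pdivrMr // (le_trans as_le) // le_eqVlt.
  apply/orP; left; apply/eqP.
  by field; rewrite !lt0r_neq0.
have small : (a s0)%:R / s%:R < eps / 2.
  rewrite ltr_pdivrMr // mulrC -ltr_pdivrMr ?divr_gt0 //.
  by near: s; apply: nbhs_infty_gtr.
lra.
Unshelve. all: by end_near. Qed.

End Ratio.

(** * The Waldschmidt constant and the containments *)

Section Waldschmidt.
Variables (R : realType) (n : nat) (K : fieldType) (e : rel 'I_n).
Hypotheses (e_sym : symmetric e) (e_irr : irreflexive e).
Hypothesis e_edge : exists i j : 'I_n, e i j.
Local Notation I := (edge_ideal K e).
Local Notation a s := (alpha (symbolic_pow I s)).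
Implicit Types (m : multinom n) (s t r : nat).

Lemma symbolic_exponent_scale q m s : symbolic_exponent e m s ->
  symbolic_exponent e (Multinom (mktuple (fun i => q * m i)%N)) (q * s).
Proof.
move=> ms C cC; under eq_bigr do rewrite mnmE.
by rewrite -big_distrr leq_mul2l ms ?orbT.
Qed.

Lemma symbolic_exponent_edge :
  exists m : multinom n, symbolic_exponent e m 1 /\ mdeg m = 2%N.
Proof.
have [i [j eij]] := e_edge; exists (mnm_add (mnm1 i) (mnm1 j)).
split=> [C /vertex_coverP/(_ _ _ eij)|]; last by rewrite mdegD !mdeg1.
by move=> /orP[kC|kC]; rewrite (bigD1 _ kC) /= mnmDE !mnm1E eqxx ?addn1.
Qed.

Lemma alpha_symbolic s :
  (exists2 m : multinom n, symbolic_exponent e m s & mdeg m = a s) /\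
  (forall m : multinom n, symbolic_exponent e m s -> (a s <= mdeg m)%N).
Proof.
rewrite symbolic_powE //; apply: alpha_mon_ideal.
have [m [m1 _]] := symbolic_exponent_edge.
have := symbolic_exponent_scale s m1; rewrite muln1.
by exists (Multinom (mktuple (fun i => s * m i)%N)).
Qed.

Lemma mdeg_scale q m :
  mdeg (Multinom (mktuple (fun i => q * m i)%N)) = (q * mdeg m)%N.
Proof. by rewrite !mdegE big_distrr; apply: eq_bigr => i _; rewrite mnmE. Qed.

Lemma alpha_symbolic_mono s t : (s <= t)%N -> (a s <= a t)%N.
Proof.
move=> st; have [[m mt <-] _] := alpha_symbolic t.
apply: (alpha_symbolic s).2 => C cC.
by apply: leq_trans st (mt C cC).
Qed.

Lemma alpha_symbolic_mul q s : (a (q * s) <= q * a s)%N.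
Proof.
have [[m ms <-] _] := alpha_symbolic s; rewrite -mdeg_scale.
by apply: (alpha_symbolic _).2; apply: symbolic_exponent_scale.
Qed.

(** The set of all vertices is a vertex cover, of weight the degree. *)
Lemma alpha_symbolic_ge s : (s <= a s)%N.
Proof.
have [[m ms <-] _] := alpha_symbolic s; rewrite mdegE.
have := ms [set: 'I_n]%SET; rewrite (eq_bigl xpredT) => [|i];
  last by rewrite inE.
by apply; apply/vertex_coverP => i j _; rewrite inE.
Qed.

Local Notation c := (waldschmidt R I).

Lemma waldschmidtP : ((a s)%:R / s%:R : R) @[s --> \oo] --> c /\
  forall s, c * s%:R <= (a s)%:R.
Proof.
have [l ul lP] :=
  ratio_cvg (a := fun s => a s) R alpha_symbolic_mono alpha_symbolic_mul.
suff -> : c = l by [].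
by apply: cvg_lim.
Qed.

Lemma waldschmidt_le2 : c <= 2.
Proof.
have [m [m1 m2]] := symbolic_exponent_edge.
have := waldschmidtP.2 1%N; rewrite mulr1.
by move=> /le_trans; apply; rewrite ler_nat -m2; apply: (alpha_symbolic 1).2.
Qed.

Lemma waldschmidt_ge1 : 1 <= c.
Proof.
have [ac _] := waldschmidtP.
rewrite -(cvg_lim (@Rhausdorff R) ac); apply: limr_ge;
  first by apply/cvg_ex; exists c.
near=> s; rewrite ler_pdivlMr ?mul1r ?ler_nat ?alpha_symbolic_ge //.
by rewrite ltr0n; near: s; exists 1%N.
Unshelve. all: by end_near. Qed.

(** The integer inequality behind the statement that [w(x) >= c / 2] on the
symbolic polyhedron for every half-integral fractional cover [w].  In the
decomposition by [half_integral_cover] the weight of [A :&: B] counts twice, and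
[c <= 2] makes this at least its share of [c * s]. *)
Lemma cover_weight_ge m s (A B : {set 'I_n}) : symbolic_exponent e m s ->
    (forall i j, e i j -> (i \in A) || (j \in B)) ->
  c * s%:R <= (\sum_(i in A) m i + \sum_(i in B) m i)%:R.
Proof.
move=> ms cov; have [k [m' [m's <-]]] := half_integral_cover e_sym ms cov.
have ck : c * (s - k)%:R <= (\sum_i m' i)%:R.
  apply: le_trans (waldschmidtP.2 _) _; rewrite ler_nat.
  have -> : (\sum_i m' i = mdeg (Multinom (mktuple m')))%N.
    by rewrite mdegE; apply: eq_bigr => i _; rewrite mnmE.
  apply: (alpha_symbolic _).2 => C cC; under eq_bigr do rewrite mnmE.
  exact: m's.
rewrite natrD -muln2 natrM.
have sk : s%:R <= k%:R + (s - k)%:R :> R by rewrite -natrD ler_nat -leq_subLR.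
have c1 := waldschmidt_ge1; have c2 := waldschmidt_le2.
have k0 : 0 <= k%:R :> R by [].
have : c * s%:R <= c * (k%:R + (s - k)%:R) by rewrite ler_pM2l //; lra.
nra.
Qed.

Lemma symbolic_pow_sub s k : k.*2%:R + (n ^ 2)%:R <= c * s%:R ->
  symbolic_pow I s `<=` ideal_pow I k.
Proof.
move=> ks; rewrite symbolic_powE //.
apply: mon_ideal_sub => [|m ms]; first exact: ideal_pow_is_ideal.
have [h [A [B [he hm cov AB]]]] := edge_packing e m.
apply: (edge_packing_pow K e_irr he hm).
rewrite -leq_double -(leq_add2r (n ^ 2)); move: AB; rewrite card_ord.
apply: leq_trans.
by rewrite -(ler_nat R) natrD (le_trans ks) //; apply: cover_weight_ge ms cov.
Qed.

Lemma symbolic_pow_nsub s r : (0 < s)%N -> c * s%:R < (r.*2)%:R ->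
  \forall t \near \oo, ~ (symbolic_pow I (s * t) `<=` ideal_pow I (r * t)).
Proof.
move=> s0 csr; have [ac _] := waldschmidtP.
have sR : 0 < s%:R :> R by rewrite ltr0n.
have : \forall N \near \oo, (a N)%:R / N%:R < (r.*2)%:R / s%:R :> R.
  by apply: cvgr_lt ac _ _; rewrite ltr_pdivlMr.
move=> [N _ aN]; exists (maxn N 1) => // t /=.
rewrite geq_max => /andP[Nt t0] sub.
have st0 : (0 < s * t)%N by rewrite muln_gt0 s0.
have /aN : (N <= s * t)%N by apply: leq_trans Nt _; apply: leq_pmull.
have stR : 0 < (s * t)%:R :> R by rewrite ltr0n.
rewrite ltr_pdivrMr //; apply/negP; rewrite -leNgt natrM mulrA.
rewrite divfK ?lt0r_neq0 //.
rewrite -natrM ler_nat; have [[m ms <-] _] := alpha_symbolic (s * t).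
have : symbolic_pow I (s * t) (mpolyX K m).
  by rewrite symbolic_powE //; apply/mon_idealX.
move=> /sub /(edge_ideal_pow_deg e_irr) -/(_ m).
rewrite msuppX mem_seq1 eqxx => /(_ isT).
by rewrite -doubleMl.
Qed.

Lemma resurgence_le : (asymptotic_resurgence R I <= (2 / c)%:E)%E.
Proof.
have c0 : 0 < c by apply: lt_le_trans waldschmidt_ge1.
apply/ereal_supP => _ [s [r [s0 r0 [t0 _ nsub] ->]]].
rewrite lee_fin ler_pdivrMr ?ltr0n // mulrAC ler_pdivlMr // leNgt.
apply/negP => lt_rs; pose d := s%:R * c - 2 * r%:R.
have d0 : 0 < d by rewrite subr_gt0.
(* Past [t], the gap [d * t] between [c * s * t] and [2 * r * t] exceeds the
   rounding loss [n ^ 2]. *)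
pose t := maxn t0 (Num.bound ((n ^ 2)%:R / d)).
apply: (nsub t); first exact: leq_maxl.
apply: symbolic_pow_sub.
have : (n ^ 2)%:R < t%:R * d.
  rewrite -ltr_pdivrMr //; apply: lt_le_trans (archi_boundP _) _.
    by rewrite divr_ge0 // ltW.
  by rewrite ler_nat leq_maxr.
by rewrite -muln2 !natrM /d; lra.
Qed.

Lemma resurgence_ge : ((2 / c)%:E <= asymptotic_resurgence R I)%E.
Proof.
have c0 : 0 < c by apply: lt_le_trans waldschmidt_ge1.
apply/lee_subgt0Pr => eps eps0.
have : Num.max 0 (2 / c - eps) < 2 / c.
  by rewrite gt_max divr_gt0 //= ltrBlDr ltrDl.
move=> /rat_in_itvoo[q]; rewrite in_itv /= gt_max => /andP[/andP[q0 qe] qc].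
have rE : ratr q = `|numq q|%:R / `|denq q|%:R :> R.
  have q_gt0 : 0 < q by rewrite -(ltr0q R).
  rewrite /ratr; congr (_ / _).
    have num_ge0 : 0 <= numq q by rewrite numq_ge0 ltW.
    by rewrite -[in LHS](gez0_abs num_ge0).
  have den_ge0 : 0 <= denq q by [].
  by rewrite -[in LHS](gez0_abs den_ge0).
apply: le_ereal_sup_tmp; exists (ratr q)%:E; last by rewrite -EFinB lee_fin ltW.
have den0 : (0 < `|denq q|)%N by rewrite absz_gt0 denq_neq0.
have num0 : (0 < `|numq q|)%N.
  by rewrite absz_gt0 numq_eq0; apply: contraTneq q0 => ->;
    rewrite rmorph0 ltxx.
exists `|numq q|%N, `|denq q|%N; split=> //; last by rewrite rE.
apply: symbolic_pow_nsub => //.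
move: qc; rewrite rE ltr_pdivrMr ?ltr0n // mulrAC ltr_pdivlMr //.
by rewrite mulrC -muln2 natrM [_ * 2]mulrC.
Qed.

End Waldschmidt.

Theorem theorem3p11 (R : realType) (K : fieldType) (n : nat) (e : rel 'I_n)
    (e_sym : symmetric e) (e_irr : irreflexive e)
    (e_edge : exists i j : 'I_n, e i j) :
  asymptotic_resurgence R (edge_ideal K e)
    = (2 / waldschmidt R (edge_ideal K e))%:E.
Proof. by apply/eqP; rewrite eq_le resurgence_le // resurgence_ge. Qed.
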